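(* For every positive integer $n$, every $n$-colorable planar map is a cross-section of a solid $K^n$.
   Context: Definitions. An $m$-dimensional region is a non-empty connected open set of dimension $m$ together with its boundary (the closure of a non-empty connected open subset of $\mathbb R^m$). Two $m$-dimensional regions are adjacent if they share a non-empty $(m-1)$-dimensional region (a common boundary segment when $m=2$, a common surface piece when $m=3$); sharing only a set of dimension at most $m-2$ does not count as adjacency. An $m$-dimensional map is a splitting of $\mathbb R^m$ into any number of $m$-dimensional regions, distinct regions having disjoint underlying open sets; for $m=2$ it is called a planar map, for $m=3$ a solid map. A map is $n$-colorable if its regions can be colored with at most $n$ colors so that adjacent regions receive different colors. An $m$-dimensional $K^n$ is a family of $n$ $m$-dimensional regions in $\mathbb R^m$ with pairwise disjoint underlying open sets that are pairwise adjacent (it need not fill $\mathbb R^m$); for $m=3$ it is called a solid $K^n$. An $m$-dimensional map $M$ is a cross-section of a family $(Y_i)$ of $(m+1)$-dimensional regions if, identifying $\mathbb R^m$ with the hyperplane $\{x_{m+1}=0\}$ of $\mathbb R^{m+1}$, each region of $M$ can be assigned an index $i$ so that for every $i$ the set $Y_i\cap\{x_{m+1}=0\}$ is the union of the regions of $M$ assigned to $i$ (possibly empty), and two distinct regions of $M$ assigned to the same $i$ are not adjacent (adjacent pieces of the same $Y_i$ count as one region).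
   Formalization: The planar map is assumed locally finite (each point has a neighbourhood meeting only finitely many regions), automatic for finite maps; for arbitrary infinitely many regions the claim fails, e.g. strips accumulating at the half-plane x ≤ 0. *)

(* Defs.v *)
From HB Require Import structures.
From mathcomp Require Import all_boot all_order all_algebra.
From mathcomp Require Import all_classical all_reals all_analysis.

Set Implicit Arguments.
Unset Strict Implicit.
Unset Printing Implicit Defensive.

Import Order.TTheory GRing.Theory Num.Theory.
Import numFieldNormedType.Exports.

Local Open Scope classical_set_scope.
Local Open Scope ring_scope.

(* A region is presented by its underlying open set; as a subset of R^m it is
   [region_set], the open set together with its boundary. The open set is kept
   as data because "disjoint" refers to it, and different open sets may have
   the same closure. *)
Record region (R : realType) (m : nat) := Region {
  open_part : set 'rV[R]_m;
  open_part_nonempty : open_part !=set0;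
  open_part_open : open open_part;
  open_part_connected : connected open_part }.

Definition region_set (R : realType) (m : nat) (U : region R m) :
  set 'rV[R]_m := closure (open_part U).

Definition embedding_on (S T : topologicalType) (A : set S) (f : S -> T) :=
  {within A, continuous f} /\
  exists g : T -> S, {in A, cancel f g} /\ {within f @` A, continuous g}.

(* The shared (m-1)-dimensional region is a homeomorphic copy of a region of
   R^(m-1): a possibly curved segment for m = 2, surface piece for m = 3.
   Only used for m >= 1. *)
Definition adjacent_regions (R : realType) (m : nat) (U V : region R m) :=
  exists (S : region R m.-1) (f : 'rV[R]_m.-1 -> 'rV[R]_m),
    embedding_on (region_set S) f /\
    f @` region_set S `<=` region_set U `&` region_set V.

Definition disjoint_regions (R : realType) (m : nat) (I : Type)
    (M : I -> region R m) :=
  trivIset [set: I] (fun i => open_part (M i)).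

Definition is_map (R : realType) (m : nat) (I : Type) (M : I -> region R m) :=
  disjoint_regions M /\ \bigcup_i region_set (M i) = [set: 'rV[R]_m].

Definition locally_finite (R : realType) (m : nat) (I : Type)
    (M : I -> region R m) :=
  forall x : 'rV[R]_m, exists2 N : set 'rV[R]_m, nbhs x N &
    finite_set [set i | region_set (M i) `&` N !=set0].

Definition colorable (R : realType) (m : nat) (I : Type) (n : nat)
    (M : I -> region R m) :=
  exists c : I -> 'I_n,
    forall i j, i <> j -> adjacent_regions (M i) (M j) -> c i <> c j.

Definition is_K (R : realType) (m n : nat) (Y : 'I_n -> region R m) :=
  disjoint_regions Y /\ forall i j, i <> j -> adjacent_regions (Y i) (Y j).

(* R^m as the hyperplane of R^(m+1) where the last coordinate vanishes. *)
Definition hyperplane_incl (R : realType) (m : nat) (x : 'rV[R]_m) :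
  'rV[R]_(m + 1) := row_mx x 0.

Definition hyperplane (R : realType) (m : nat) : set 'rV[R]_(m + 1) :=
  [set y | y ord0 (rshift m ord0) = 0].

Definition cross_section (R : realType) (m : nat) (I J : Type)
    (M : I -> region R m) (Y : J -> region R (m + 1)) :=
  exists a : I -> J,
    (forall j, region_set (Y j) `&` @hyperplane R m =
       @hyperplane_incl R m @` (\bigcup_(i in a @^-1` [set j]) region_set (M i)))
    /\
    (forall i i', i <> i' -> a i = a i' -> ~ adjacent_regions (M i) (M i')).

(* Main.v *)
Require Import Defs.
From mathcomp Require Import all_boot all_order all_algebra finmap.
From mathcomp Require Import all_classical all_reals all_analysis.
From mathcomp Require Import ring lra.

(** Let [c] colour the regions [M i], with open parts [U_i], by [n] colours.
    The solid region of colour [j] is a tower of four storeys over the plane: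
    at a height strictly between [k] and [k + 1] its horizontal section is a
    fixed open set [layer j k], and at height [k + 1] it is the intersection
    of [layer j k] and [layer j k.+1]. Such a set is open, towers of different
    colours are disjoint as soon as their layers are ([tower_disjoint]), and
    the closure of a tower meets the plane of height [0] exactly in the
    closure of its ground layer ([tower_base]).

    - Layer 0 is the union of the [U_i] of colour [j]. By local finiteness its
      closure is the union of the corresponding closed regions, which is the
      cross-section condition.
    - Layer 2 consists of the stripes [k n + j < x < k n + j + 1], with [k] any
      integer, and layer 3 of the single strip [j < y < j + 1]. The strip
      crosses all the stripes of colour [j], so the two upper storeys
      are connected. For any two colours [j] and [j'] a stripe of [j] below and
      the strip of [j'] above share a unit square at height [3], so the solids
      are pairwise adjacent, even for colours that no region carries.
    - Layer 1 links each region to the stripes of its own colour. A point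
      [q_i] is chosen in [U_i], and a thin open bar is laid from it in the
      direction of increasing [x], of length more than [2 n], so that it meets
      a stripe of each colour. Bars of different colours have to be disjoint.
      The ordinate of [q_i] is taken in a dense set attached to the colour of
      [i], the sets of different colours being disjoint
      ([residue_fraction_disjoint], [residue_fraction_dense]); thus the axes
      of bars of different colours are disjoint. Only finitely many regions
      come near a given bar, so all bars can be made thin enough
      ([exists_disjoint_bars]). *)

Set Implicit Arguments.
Unset Strict Implicit.
Unset Printing Implicit Defensive.

Import Order.TTheory GRing.Theory Num.Theory.
Import numFieldNormedType.Exports.

Local Open Scope classical_set_scope.
Local Open Scope ring_scope.

(** * Topological preliminaries *)

Lemma continuous_rV (R : realType) (m : nat) (T : topologicalType)
    (f : T -> 'rV[R]_m) :
  (forall j, continuous (fun t => f t ord0 j)) -> continuous f.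
Proof.
move=> cf t A [P Pt PA]; apply: (@filterS _ _ _
  [set s | forall j, P ord0 j (f s ord0 j)]).
  by move=> s Ps; apply: PA => i j; rewrite (ord1 i).
by apply: filter_forall => j; exact: (cf j t _ (Pt ord0 j)).
Qed.

Lemma continuous_translate (R : realType) (T : topologicalType) (a : R)
    (f : T -> R) :
  continuous f -> continuous (fun t => a + f t).
Proof. by move=> cf t; apply: cvgD; [exact: cvg_cst|exact: cf]. Qed.

Lemma connected_component_seg (R : realType) (T : topologicalType)
    (A : set T) (f : R -> T) (a b : R) :
  a <= b -> continuous f -> (forall t, a <= t <= b -> A (f t)) ->
  connected_component A (f a) (f b).
Proof.
move=> ab cf Af; exists (f @` `[a, b]); last first.
  by exists b => //=; rewrite in_itv/= ab lexx.
split.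
- by exists a => //=; rewrite in_itv/= ab lexx.
- by move=> _ [t + <-]; rewrite /= in_itv/=; exact: Af.
- apply: connected_continuous_connected; first exact: segment_connected.
  exact: continuous_subspaceT.
Qed.

Lemma closure_path_start (R : realType) (T : topologicalType) (A : set T)
    (f : R -> T) (a b : R) :
  a < b -> continuous f -> (forall t, a < t < b -> A (f t)) -> closure A (f a).
Proof.
move=> ab cf Af B fB.
have : \forall t \near a^'+, B (f t) /\ a < t < b.
  near=> t; split; first by near: t; exact: (cvg_at_right_filter (cf a)).
  apply/andP; split; near: t; first exact: nbhs_right_gt.
  exact: nbhs_right_lt.
by move=> /(@filter_ex _ _ (at_right_proper_filter a))[t [Bt abt]];
  exists (f t); split=> //; exact: Af.
Unshelve. all: by end_near. Qed.

Lemma closure_path_end (R : realType) (T : topologicalType) (A : set T)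
    (f : R -> T) (a b : R) :
  a < b -> continuous f -> (forall t, a < t < b -> A (f t)) -> closure A (f b).
Proof.
move=> ab cf Af B fB.
have : \forall t \near b^'-, B (f t) /\ a < t < b.
  near=> t; split; first by near: t; exact: (cvg_at_left_filter (cf b)).
  apply/andP; split; near: t; first exact: nbhs_left_gt.
  exact: nbhs_left_lt.
by move=> /(@filter_ex _ _ (at_left_proper_filter b))[t [Bt abt]];
  exists (f t); split=> //; exact: Af.
Unshelve. all: by end_near. Qed.

Lemma closure_continuous (S T : topologicalType) (f : S -> T)
    (A : set S) (B : set T) :
  continuous f -> (forall x, A x -> closure B (f x)) ->
  forall x, closure A x -> closure B (f x).
Proof.
move=> cf AB x clx; suff : closure (closure B) (f x).
  by rewrite -(closure_id _).1 //; exact: closed_closure.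
by move=> V /(cf x) /clx[y [Ay Vy]]; exists (f y); split=> //; exact: AB.
Qed.

Section locally_finite_families.
Variables (T : ptopologicalType) (I : choiceType) (A : I -> set T).
Hypothesis lfA : forall x : T, exists2 N : set T, nbhs x N &
  finite_set [set i | closure (A i) `&` N !=set0].

(** Near a given point only finitely many members matter, and closure
    commutes with finite unions. *)
Lemma closure_bigcup_locally_finite (D : set I) :
  closure (\bigcup_(i in D) A i) = \bigcup_(i in D) closure (A i).
Proof.
apply/seteqP; split => [x clx|x [i Di clx]]; last first.
  by apply: closureS clx; exact: bigcup_sup.
have [N xN finN] := lfA x.
pose F := D `&` [set i | closure (A i) `&` N !=set0].
have clF : closed (\bigcup_(i in F) closure (A i)).
  apply: closed_bigcup => [|i _]; first exact: finite_setIr.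
  exact: closed_closure.
suff : closure (\bigcup_(i in F) closure (A i)) x.
  by rewrite -(closure_id _).1 // => -[i [Di _] Ai]; exists i.
move=> V xV; have [y [[i Di Ay] [Vy Ny]]] := clx _ (filterI xV xN).
exists y; split=> //; exists i; last exact: subset_closure.
by split=> //; exists y; split=> //; exact: subset_closure.
Qed.

(** Finitely many of the neighbourhoods given by local finiteness cover a
    compact set, and each meets finitely many members. *)
Lemma compact_locally_finite (K : set T) : compact K ->
  finite_set [set i | closure (A i) `&` K !=set0].
Proof.
rewrite compact_cover => cK.
have [N N1] := choice (fun x => (exists2P _ _).1 (lfA x)).
have [|x Kx|E _ KE] := cK T setT (fun x => (N x)°).
- by move=> x _; exact: open_interior.
- by exists x => //; exact: (N1 x).1.
have /sub_finite_set : [set i | closure (A i) `&` K !=set0] `<=`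
    \bigcup_(x in [set` E]) [set i | closure (A i) `&` N x !=set0].
  move=> i [y [Ay /KE[x Ex Nx]]]; exists x => //; exists y; split=> //.
  exact: interior_subset.
apply; apply: bigcup_finite => [|x _]; [exact: finite_fset|exact: (N1 x).2].
Qed.

End locally_finite_families.

Lemma finite_set_lower_bound (R : realType) (I : Type) (D : set I)
    (f : I -> R) :
  finite_set D -> (forall i, D i -> 0 < f i) ->
  exists2 e, 0 < e & forall i, D i -> e <= f i.
Proof.
move=> /(@finite_image _ _ _ f) /finite_seqP[s fs] f0.
have : {in s, forall x, 0 < x}.
  by move=> x xs; have : [set` s] x by []; rewrite -fs => -[i Di <-]; exact: f0.
have : forall i, D i -> f i \in s.
  by move=> i Di; have : (f @` D) (f i) by []; rewrite fs.
move: s {fs} => s Ds s0; exists (\big[Num.min/1]_(x <- s) x).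
  by rewrite big_seq; apply: lt_bigmin => // x xs; exact: s0.
by move=> i /Ds xs; exact: ge_bigmin_seq.
Qed.

(** * Towers *)

Definition at_height (R : realType) (m : nat) (q : 'rV[R]_m) (z : R) :
  'rV[R]_(m + 1) := row_mx q (const_mx z).

Definition height (R : realType) (m : nat) (p : 'rV[R]_(m + 1)) : R :=
  p ord0 (rshift m ord0).

Lemma height_at (R : realType) m (q : 'rV[R]_m) z : height (at_height q z) = z.
Proof. by rewrite /height row_mxEr mxE. Qed.

Lemma lsubmx_at (R : realType) m (q : 'rV[R]_m) z : lsubmx (at_height q z) = q.
Proof. exact: row_mxKl. Qed.

Lemma at_heightK (R : realType) m (p : 'rV[R]_(m + 1)) :
  at_height (lsubmx p) (height p) = p.
Proof.
rewrite -[RHS]hsubmxK; congr row_mx; apply/rowP => j.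
by rewrite !mxE (ord1 j).
Qed.

Lemma continuous_height (R : realType) m : continuous (@height R m).
Proof. exact: coord_continuous. Qed.

Lemma continuous_at_height (R : realType) (m : nat) (T : topologicalType)
    (f : T -> 'rV[R]_m) (h : T -> R) :
  continuous f -> continuous h -> continuous (fun t => at_height (f t) (h t)).
Proof.
move=> cf ch; apply: continuous_rV => j; rewrite -(splitK j).
case: (fintype.split j) => k /=.
  under eq_fun do rewrite row_mxEl.
  move=> t; apply: (@continuous_comp _ _ _ f (fun q : 'rV_m => q ord0 k)).
    exact: cf.
  exact: coord_continuous.
under eq_fun do rewrite row_mxEr mxE.
exact: ch.
Qed.

Section tower.
Variables (R : realType) (m N : nat).
Implicit Types (P : nat -> set 'rV[R]_m) (p : 'rV[R]_(m + 1)) (q : 'rV[R]_m).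

(** The bounds on the height in the second clause are not strict: at an
    integer height the section is constrained by the two storeys that meet
    there. This makes the clause, for each storey, an open condition, namely
    that the height is below the storey, or above it, or that the projection
    is in the layer. *)
Definition tower P : set 'rV[R]_(m + 1) :=
  [set p | 0 < height p < N%:R /\
    forall k, (k < N)%N -> k%:R <= height p <= k.+1%:R -> P k (lsubmx p)].

Lemma tower_at P q z : tower P (at_height q z) <-> 0 < z < N%:R /\
    forall k, (k < N)%N -> k%:R <= z <= k.+1%:R -> P k q.
Proof. by rewrite /tower /= height_at lsubmx_at. Qed.

Lemma near_height p (V : set R) :
  open V -> V (height p) -> \forall p' \near p, V (height p').
Proof. by move=> oV Vp; apply: continuous_height; exact: open_nbhs_nbhs. Qed.

Lemma tower_open P : (forall k, (k < N)%N -> open (P k)) -> open (tower P).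
Proof.
move=> oP; rewrite openE => p [hp Pp]; rewrite /interior.
suff : \forall p' \near p, 0 < height p' < N%:R /\
    forall k : 'I_N, k%:R <= height p' <= k.+1%:R -> P k (lsubmx p').
  apply: filterS => p' [? Pp']; split=> // k kN.
  exact: (Pp' (Ordinal kN)).
apply: filterI.
  near=> p'; apply/andP; split; near: p'.
    by apply: (@near_height _ [set z | 0 < z]); [exact: open_gt|case/andP: hp].
  by apply: (@near_height _ [set z | z < N%:R]); [exact: open_lt|case/andP: hp].
suff H : forall k : 'I_N, \forall p' \near p,
    k%:R <= height p' <= k.+1%:R -> P k (lsubmx p').
  exact: (@filter_forall _ _ _ _ (nbhs_filter p) H).
move=> k.
have [Pk|nPk] := pselect (P k (lsubmx p)).
  have : \forall p' \near p, P k (lsubmx p').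
    by apply: continuous_lsubmx; apply: open_nbhs_nbhs; split=> //; exact: oP.
  by apply: filterS => p' Pp' _.
have [kp|kp] := ltP (height p) k%:R.
  have : \forall p' \near p, height p' < k%:R.
    by apply: (@near_height _ [set z | z < k%:R]) => //; exact: open_lt.
  by apply: filterS => p' h /andP[]; rewrite leNgt h.
have [kp'|kp'] := ltP k.+1%:R (height p).
  have : \forall p' \near p, k.+1%:R < height p'.
    by apply: (@near_height _ [set z | k.+1%:R < z]) => //; exact: open_gt.
  by apply: filterS => p' h /andP[_]; rewrite leNgt h.
by exfalso; apply: nPk; apply: Pp => //; rewrite kp kp'.
Unshelve. all: by end_near. Qed.

Lemma exists_floor (z : R) : 0 < z < N%:R ->
  exists2 k, (k < N)%N & k%:R <= z <= k.+1%:R.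
Proof.
move=> /andP[z0 zN]; have /andP[h1 h2] := truncn_itv (ltW z0).
exists (Num.truncn z); last by rewrite h1 ltW.
by rewrite -(ltr_nat R); exact: le_lt_trans zN.
Qed.

Lemma tower_disjoint P P' :
  (forall k, (k < N)%N -> P k `&` P' k = set0) -> tower P `&` tower P' = set0.
Proof.
move=> PP'; apply/seteqP; split=> // p [[hp Pp] [_ Pp']].
have [k kN hk] := exists_floor hp.
suff : (P k `&` P' k) (lsubmx p) by rewrite PP'.
by split; [exact: Pp|exact: Pp'].
Qed.

Definition mid (k : nat) : R := k%:R + 2^-1.

Lemma tower_floor P q k z : (k < N)%N -> P k q -> k%:R < z < k.+1%:R ->
  tower P (at_height q z).
Proof.
move=> kN Pq /andP[h1 h2]; apply/tower_at; split.
  apply/andP; split; first exact: le_lt_trans h1.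
  by apply: (lt_le_trans h2); rewrite ler_nat.
move=> k' _ /andP[h3 h4]; suff -> : k' = k by [].
apply/eqP; rewrite eqn_leq; apply/andP; split.
  by rewrite -ltnS -(ltr_nat R); exact: le_lt_trans h2.
by rewrite -ltnS -(ltr_nat R); exact: lt_le_trans h4.
Qed.

Lemma mid_itv k : k%:R < mid k < k.+1%:R.
Proof. by rewrite /mid -(natr1 k); lra. Qed.

Lemma tower_vertical P q z z' :
  (forall t, Num.min z z' <= t <= Num.max z z' -> tower P (at_height q t)) ->
  connected_component (tower P) (at_height q z) (at_height q z').
Proof.
have cq : continuous (fun t : R => at_height q t).
  by apply: continuous_at_height => x; [exact: cvg_cst|exact: cvg_id].
have [zz'|/ltW zz'] := leP z z' => H.
  exact: (connected_component_seg zz' cq).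
by apply: connected_component_sym; exact: (connected_component_seg zz' cq).
Qed.

(** The way to prove a tower connected: every point can be moved vertically
    to the middle of a storey that contains it. It then remains to join points
    at mid-storey height, by moves within a layer ([tower_horizontal]) and by
    moves up through the intersection of consecutive layers
    ([tower_climb]). *)
Lemma tower_to_mid P q z : tower P (at_height q z) -> exists k,
  [/\ (k < N)%N, P k q &
  connected_component (tower P) (at_height q z) (at_height q (mid k))].
Proof.
move=> Pqz; have /tower_at[hz Pz] := Pqz; have [k kN hk] := exists_floor hz.
exists k; split=> //; first exact: Pz.
have /andP[m1 m2] := mid_itv k; have /andP[k1 k2] := hk.
apply: tower_vertical => t; rewrite ge_min le_max => /andP[h1 h2].
(* If [z] is an integer, the other points of the vertical segment are still
   strictly inside the storey [k], so that only [P k] constrains them. *)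
have [->//|tz] := eqVneq t z.
apply: (@tower_floor _ _ k) => //; first exact: Pz.
move: tz; rewrite neq_lt => /orP[tz|tz]; lra.
Qed.

Lemma tower_climb P q k : (k.+1 < N)%N -> P k q -> P k.+1 q ->
  connected_component (tower P) (at_height q (mid k)) (at_height q (mid k.+1)).
Proof.
move=> kN Pk Pk1; have /andP[m1 m2] := mid_itv k.
have /andP[m3 m4] := mid_itv k.+1.
have kk1 : mid k <= mid k.+1 by rewrite /mid lerD2r ler_nat.
apply: tower_vertical => t; rewrite ge_min le_max => /andP[h1 h2].
have h1' : k%:R < t by lra.
have h2' : t < k.+2%:R by lra.
apply/tower_at; split.
  apply/andP; split; first exact: le_lt_trans h1'.
  by apply: (lt_le_trans h2'); rewrite ler_nat.
move=> k' _ /andP[h3 h4].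
have : (k' < k.+2)%N by rewrite -(ltr_nat R); exact: le_lt_trans h2'.
have : (k <= k')%N by rewrite -ltnS -(ltr_nat R); exact: lt_le_trans h4.
rewrite leq_eqVlt => /orP[/eqP<-//|kk'] kk''.
by have -> : k' = k.+1 by apply/eqP; rewrite eqn_leq kk' -ltnS kk''.
Qed.

Lemma tower_horizontal P C q q' k : (k < N)%N -> connected C -> C `<=` P k ->
  C q -> C q' ->
  connected_component (tower P) (at_height q (mid k)) (at_height q' (mid k)).
Proof.
move=> kN cC CP Cq Cq'.
exists ((fun x => at_height x (mid k)) @` C); last by exists q'.
split; first by exists q.
  move=> _ [x Cx <-]; apply: (@tower_floor _ _ k) => //; first exact: CP.
  exact: mid_itv.
apply: connected_continuous_connected => //.
apply: continuous_subspaceT; apply: continuous_at_height => x.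
  exact: cvg_id.
exact: cst_continuous.
Qed.

(** Below height [1] the tower is a cylinder over its ground layer; a point of
    height [0] in the closure is thus approached from inside that cylinder. *)
Lemma tower_base P : (0 < N)%N ->
  closure (tower P) `&` @hyperplane R m = @hyperplane_incl R m @` closure (P 0).
Proof.
move=> N0; apply/seteqP; split => [p [clp p0]|_ [q clq <-]].
  exists (lsubmx p); last first.
    by rewrite -[RHS]at_heightK [height p]p0.
  move=> V /(@continuous_lsubmx _ _ _ _ p) Vp.
  have : \forall p' \near p, height p' < 1.
    apply: (near_height (V := [set z | z < 1])); first exact: open_lt.
    by rewrite [height p]p0 /= ltr01.
  move=> near1; have /clp[p' [[/andP[h0 _] Pp'] [Vp' h1]]] :=
    @filterI _ _ (nbhs_filter p) _ _ Vp near1.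
  by exists (lsubmx p'); split=> //; apply: (Pp' 0) => //; rewrite !ltW.
split; last by rewrite /hyperplane /= row_mxEr mxE.
rewrite -[hyperplane_incl q]/(at_height q 0).
apply: (@closure_continuous _ _ (fun q => at_height q 0) (P 0)) clq.
  by apply: continuous_at_height => x; [exact: cvg_id|exact: cst_continuous].
move=> {}q Pq.
apply: (@closure_path_start _ _ _ (fun z => at_height q z) 0 1) => //.
  by apply: continuous_at_height => x; [exact: cvg_cst|exact: cvg_id].
by move=> t t01; apply: (@tower_floor _ _ 0).
Qed.
End tower.

(** * Rectangles in the plane *)

Lemma ord2_max (k : 'I_2) : k <> ord0 -> k = ord_max.
Proof.
case: k => [[|[|k]] lt2] //= k0; apply/val_inj => //=.
by case: k0; exact/val_inj.
Qed.

Section plane.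
Variable R : realType.
Implicit Types (q : 'rV[R]_2) (A B : set R).

Definition xc q : R := q ord0 ord0.
Definition yc q : R := q ord0 ord_max.
Definition pt2 (x y : R) : 'rV[R]_2 := \row_k (if k == ord0 then x else y).

Lemma xc_pt2 x y : xc (pt2 x y) = x. Proof. by rewrite /xc mxE. Qed.
Lemma yc_pt2 x y : yc (pt2 x y) = y. Proof. by rewrite /yc mxE. Qed.

Lemma pt2K q : pt2 (xc q) (yc q) = q.
Proof.
by apply/rowP => -[[|[|k]] lt2] //; rewrite mxE /xc /yc /=;
  congr (q _ _); apply/val_inj.
Qed.

Lemma continuous_pt2 (T : topologicalType) (f g : T -> R) :
  continuous f -> continuous g -> continuous (fun t => pt2 (f t) (g t)).
Proof.
move=> cf cg; apply: continuous_rV => j.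
under eq_fun do rewrite mxE.
by case: (j == ord0).
Qed.

Definition prod2 A B : set 'rV[R]_2 := [set q | A (xc q) /\ B (yc q)].

Lemma prod2_open A B : open A -> open B -> open (prod2 A B).
Proof.
move=> oA oB; apply: (@openI _ (xc @^-1` A) (yc @^-1` B)).
  by apply: open_comp => // q _; exact: coord_continuous.
by apply: open_comp => // q _; exact: coord_continuous.
Qed.

Lemma prod2_connected A B : connected A -> connected B ->
  connected (prod2 A B).
Proof.
move=> cA cB; have [[p [Ax By]]|] := pselect (prod2 A B !=set0); last first.
  by move=> /nonemptyPn ->; exact: connected0.
suff -> : prod2 A B = connected_component (prod2 A B) p.
  exact: component_connected.
apply/seteqP; split; last exact: connected_component_sub.
move=> q [Aq Bq]; apply: (@connected_component_trans _ _ (pt2 (xc q) (yc p))).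
  exists ((fun x => pt2 x (yc p)) @` A); last by exists (xc q).
  split; first by exists (xc p) => //; exact: pt2K.
    by move=> _ [x ? <-]; split; rewrite ?xc_pt2 ?yc_pt2.
  apply: connected_continuous_connected => //; apply: continuous_subspaceT.
  by apply: continuous_pt2 => x; [exact: cvg_id|exact: cst_continuous].
exists ((fun y => pt2 (xc q) y) @` B); last by exists (yc q) => //; exact: pt2K.
split; first by exists (yc p).
  by move=> _ [x ? <-]; split; rewrite ?xc_pt2 ?yc_pt2.
apply: connected_continuous_connected => //; apply: continuous_subspaceT.
by apply: continuous_pt2 => x; [exact: cst_continuous|exact: cvg_id].
Qed.

Lemma itv_connected (i : interval R) : connected [set` i].
Proof. by apply/connected_intervalP; exact: interval_is_interval. Qed.

Lemma real_connected : connected [set: R].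
Proof. by rewrite -set_itvNyy; exact: itv_connected. Qed.

End plane.

(** * Residue classes on the line *)

Section residues.
Variables (R : realType) (n : nat).

Lemma eq_residue (j j' : nat) (k k' : int) : (j < n)%N -> (j' < n)%N ->
  k * n%:Z + j%:Z = k' * n%:Z + j'%:Z -> j = j'.
Proof.
move=> jn j'n /(congr1 (fun a => (a %% n%:Z)%Z)); rewrite !modzMDl.
by rewrite !modz_small ?lez_nat ?ltz_nat //= => -[].
Qed.

Definition stripe (j : nat) : set R :=
  [set x | exists k : int,
     (k * n%:Z + j%:Z)%:~R < x < (k * n%:Z + j%:Z)%:~R + 1].

Lemma stripe_disjoint j j' x :
  (j < n)%N -> (j' < n)%N -> stripe j x -> stripe j' x -> j = j'.
Proof.
move=> jn j'n [k /andP[h1 h2]] [k' /andP[h3 h4]].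
apply: (@eq_residue _ _ k k') => //.
have lt1 (a b : int) : a%:~R < x -> x < b%:~R + 1 -> a <= b.
  move=> ax xb; rewrite -ltzD1 -(ltr_int R) intrD; exact: lt_trans xb.
by apply/eqP; rewrite eq_le; apply/andP; split; exact: lt1.
Qed.

Lemma stripe_open j : open (stripe j).
Proof.
rewrite (_ : stripe j = \bigcup_(k : int)
    `](k * n%:Z + j%:Z)%:~R, ((k * n%:Z + j%:Z)%:~R + 1)[%classic).
  by apply: bigcup_open => k _; exact: interval_open.
apply/seteqP; split=> [x [k hk]|x [k _ /=]].
  by exists k => //=; rewrite in_itv.
by rewrite in_itv /= => hk; exists k.
Qed.

Lemma stripe_near (x : R) j : (j < n)%N ->
  exists2 x', stripe j x' & x < x' < x + (2 * n)%:R.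
Proof.
move=> jn; have n0 : (0 : R) < n%:R by rewrite ltr0n; case: (n) jn.
have /andP[f1 f2] := floor_itv (x / n%:R).
set k := Num.floor _ in f1 f2.
have {}f1 : k%:~R * n%:R <= x by rewrite -ler_pdivlMr.
have {}f2 : x < (k + 1)%:~R * n%:R by rewrite -ltr_pdivrMr.
have jn' : j%:R + 1 <= n%:R :> R by rewrite natr1 ler_nat.
have j0 : 0 <= j%:R :> R by [].
(* The midpoint of the first interval of class [j] that starts at or after the
   next multiple of [n] following [x]. *)
exists (((k + 1) * n%:Z + j%:Z)%:~R + 2^-1).
  by exists (k + 1); rewrite ltrDl ltrD2l; apply/andP; split; lra.
rewrite !(intrD, intrM) -!pmulrn natrM in f1 f2 *.
by apply/andP; split; lra.
Qed.

(** The fractions [(k n + j) / (n + 1) ^ m]. Putting two of them over a common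
    denominator multiplies the numerators by powers of [n + 1], which is
    congruent to [1] modulo [n]; so the classes of the numerators do not
    change, and different [j] give disjoint sets. Each of these sets is dense
    because the spacing [n / (n + 1) ^ m] tends to [0]. *)
Definition residue_fraction (j : nat) : set R :=
  [set y | exists (k : int) (m : nat),
     y * n.+1%:R ^+ m = (k * n%:Z + j%:Z)%:~R].

Lemma residue_fraction_disjoint j j' y :
  (j < n)%N -> (j' < n)%N ->
  residue_fraction j y -> residue_fraction j' y -> j = j'.
Proof.
have pow1 m : exists t : int, n.+1%:Z ^+ m = t * n%:Z + 1.
  elim: m => [|m [t IH]]; first by exists 0; rewrite expr0 mul0r add0r.
  by exists (t * n.+1%:Z + 1); rewrite exprSr IH -addn1 PoszD; ring.
move=> jn j'n [k [m ym]] [k' [m' ym']].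
have [t tm] := pow1 m; have [t' tm'] := pow1 m'.
have E : (k * n%:Z + j%:Z) * n.+1%:Z ^+ m' = (k' * n%:Z + j'%:Z) * n.+1%:Z ^+ m.
  apply: (@intr_inj R).
  by rewrite [LHS]intrM [RHS]intrM -ym -ym' !rmorphXn /= -!pmulrn; ring.
(* Modulo [n] both powers of [n + 1] are [1], so the two sides of [E] are
   congruent to [j] and [j'] respectively. *)
apply: (@eq_residue _ _ (k * n%:Z * t' + k + j%:Z * t')
  (k' * n%:Z * t + k' + j'%:Z * t)) => //.
move: E; rewrite tm tm' => E.
transitivity ((k * n%:Z + j%:Z) * (t' * n%:Z + 1)); first by ring.
by rewrite E; ring.
Qed.

Lemma residue_fraction_dense j (y e : R) : (0 < n)%N -> 0 < e ->
  exists2 y', residue_fraction j y' & y - e < y' <= y.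
Proof.
move=> n0 e0; have n0' : (0 : R) < n%:R by rewrite ltr0n.
(* A denominator for which the spacing is smaller than [e]. *)
pose m := (Num.truncn (n%:R / e)).+1.
pose d : R := n.+1%:R ^+ m.
have d0 : 0 < d by rewrite exprn_gt0.
have dm : n%:R < e * d.
  rewrite mulrC -ltr_pdivrMr //; apply: (lt_trans (truncnS_gt _)).
  by rewrite /d -natrX ltr_nat ltn_expl.
have /andP[f1 f2] := floor_itv ((y * d - j%:R) / n%:R).
set k := Num.floor _ in f1 f2.
have {}f1 : k%:~R * n%:R <= y * d - j%:R by rewrite -ler_pdivlMr.
have {}f2 : y * d - j%:R < (k + 1)%:~R * n%:R by rewrite -ltr_pdivrMr.
exists ((k * n%:Z + j%:Z)%:~R / d).
  by exists k, m; rewrite divfK // gt_eqF.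
rewrite ler_pdivrMr // ltr_pdivlMr // !(intrD, intrM) -!pmulrn in f1 f2 *.
by apply/andP; split; lra.
Qed.

End residues.

(** * Disjoint bars *)

Section bars.
Variables (R : realType) (I : choiceType) (C : Type).
Variables (M : I -> region R 2) (c : I -> C) (q : I -> 'rV[R]_2).
Hypothesis lfM : locally_finite M.
Hypothesis Mq : forall i, region_set (M i) (q i).
Hypothesis yc_neq : forall i j, c i <> c j -> yc (q i) <> yc (q j).

(** The bar starts a little before [p], so that this open set contains [p]. *)
Definition bar (r : R) (p : 'rV[R]_2) (e : R) : set 'rV[R]_2 :=
  prod2 `]xc p - e, xc p + r[ `]yc p - e, yc p + e[.

(** The points [q j] that satisfy the two bounds lie in a compact box, which
    meets finitely many regions; the smallest of finitely many positive
    vertical distances is positive. *)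
Lemma exists_vertical_gap (r : R) (i : I) : exists e : R, [/\ 0 < e, e <= 1 &
  forall j, c i <> c j -> `|xc (q j) - xc (q i)| <= r ->
    `|yc (q j) - yc (q i)| <= 2 -> 2 * e <= `|yc (q j) - yc (q i)|].
Proof.
pose side (k : 'I_2) : set R := if k == ord0
  then `[xc (q i) - r, xc (q i) + r]%classic
  else `[yc (q i) - 2, yc (q i) + 2]%classic.
pose box : set 'rV[R]_2 := [set p | forall k, side k (p ord0 k)].
have box_compact : compact box.
  apply: (@rV_compact R 2 side) => k.
  by rewrite /side; case: ifP => _; exact: segment_compact.
pose D := [set j | c i <> c j] `&` [set j | region_set (M j) `&` box !=set0].
have finD : finite_set D.
  exact/finite_setIr/(@compact_locally_finite _ _ (fun j => open_part (M j))).
have [j [ij _]|e e0 eD] := @finite_set_lower_bound R _ D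
    (fun j => `|yc (q j) - yc (q i)|) finD.
  by rewrite normr_gt0 subr_eq0; apply/eqP/nesym/yc_neq.
exists (Num.min 1 (e / 2)); split.
- by rewrite lt_min ltr01 divr_gt0.
- by rewrite ge_min lexx.
- move=> j ij xij yij; apply: (@le_trans _ _ e).
    by rewrite mulrC -ler_pdivlMr // ge_min lexx orbT.
  apply: eD; split=> //; exists (q j); split=> // k.
  move: xij yij; rewrite !ler_norml => /andP[x1 x2] /andP[y1 y2].
  rewrite /side; case: eqP => [->|]; rewrite /= in_itv /=.
    by rewrite -/(xc _); apply/andP; split; lra.
  by move=> /ord2_max->; rewrite -/(yc _); apply/andP; split; lra.
Qed.

(** If two bars met, the vertical distance of their axes would be less than
    twice the larger half-width, while their starting points would be at
    horizontal distance less than [r + 1]. This contradicts the choice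
    of the larger half-width. *)
Lemma exists_disjoint_bars (r : R) : 0 <= r -> exists e : I -> R,
  (forall i, 0 < e i) /\
  forall i j, c i <> c j -> bar r (q i) (e i) `&` bar r (q j) (e j) = set0.
Proof.
move=> r0; have [e eP] := choice (exists_vertical_gap (r + 1)).
exists e; split=> [i|]; first by have [] := eP i.
suff H i j : c i <> c j -> e j <= e i ->
    bar r (q i) (e i) `&` bar r (q j) (e j) = set0.
  by move=> i j ij; have [/H->//|/ltW/H] := leP (e j) (e i);
    rewrite setIC; apply; exact: nesym.
move=> ij eji; have [ei0 ei1 ei] := eP i; have [ej0 ej1 _] := eP j.
apply/seteqP; split=> // p [[]].
rewrite /= !in_itv /= => /andP[a1 a2] /andP[a3 a4].
case; rewrite /= !in_itv /= => /andP[b1 b2] /andP[b3 b4].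
have yij : `|yc (q j) - yc (q i)| < 2 * e i by rewrite ltr_norml; lra.
have := yij; rewrite ltNge ei //; first by rewrite ler_norml; lra.
by move: yij; rewrite ltr_norml ler_norml; lra.
Qed.

End bars.

(** * The solid regions *)

Section construction.
Variables (R : realType) (n : nat) (I : choiceType) (M : I -> region R 2).
Variable c : I -> 'I_n.
Hypothesis disjM : disjoint_regions M.
Hypothesis lfM : locally_finite M.

Variables (q : I -> 'rV[R]_2) (e : I -> R).
Hypothesis Uq : forall i, open_part (M i) (q i).
Hypothesis e_gt0 : forall i, 0 < e i.
Let bar_of i := bar (2 * n)%:R (q i) (e i).
Hypothesis bars_disjoint : forall i j, c i <> c j ->
  bar_of i `&` bar_of j = set0.

Definition layer (j : 'I_n) (k : nat) : set 'rV[R]_2 :=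
  match k with
  | 0 => \bigcup_(i in c @^-1` [set j]) open_part (M i)
  | 1 => \bigcup_(i in c @^-1` [set j]) bar (2 * n)%:R (q i) (e i)
  | 2 => prod2 (stripe n j) setT
  | _ => prod2 setT `]j%:R, (j%:R + 1)[
  end.

Lemma layer_open j k : open (layer j k).
Proof.
case: k => [|[|[|k]]] /=.
- by apply: bigcup_open => i _; exact: open_part_open.
- by apply: bigcup_open => i _; apply: prod2_open; exact: interval_open.
- by apply: prod2_open; [exact: stripe_open|exact: openT].
- by apply: prod2_open; [exact: openT|exact: interval_open].
Qed.

Lemma layer_disjoint j j' k : j <> j' -> layer j k `&` layer j' k = set0.
Proof.
move=> jj'; apply/seteqP; split=> // p.
have neq_nat : (j : nat) <> j' by move=> /val_inj.
case: k => [|[|[|k]]] /=.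
- move=> [[i ij pi] [i' ij' pi']]; apply: jj'.
  by rewrite -ij -ij'; congr c; apply: disjM => //; exists p.
- move=> [[i ij pi] [i' ij' pi']].
  suff : (bar_of i `&` bar_of i') p by rewrite bars_disjoint //= ij ij'.
  by split.
- move=> [[pj _] [pj' _]]; apply: neq_nat.
  exact: stripe_disjoint pj pj'.
- move=> [[_ +] [_ +]]; rewrite /= !in_itv /= => /andP[a1 a2] /andP[b1 b2].
  apply: neq_nat.
  apply/eqP; rewrite eqn_leq; apply/andP.
  by split; rewrite -ltnS -(ltr_nat R) -natr1;
    [exact: lt_trans b2|exact: lt_trans a2].
Qed.

Definition body j : set 'rV[R]_(2 + 1) := tower 4 (layer j).

Let base (j : 'I_n) : 'rV[R]_(2 + 1) :=
  at_height (pt2 (j%:R + 2^-1) (j%:R + 2^-1)) (mid R 3).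

Lemma half_itv (x : R) : x < x + 2^-1 < x + 1.
Proof. by apply/andP; split; lra. Qed.

(** Everything is joined to one point of the uppermost storey: a point over
    [U_i] goes within [U_i] to [q i], up into the bar, along the bar to a
    stripe of colour [j], up into that stripe, along the stripe to the strip
    of colour [j], and up into the strip. *)
Lemma body_connected j : connected (body j).
Proof.
have top p : layer j 3 p ->
    connected_component (body j) (at_height p (mid R 3)) (base j).
  move=> p3; apply: (@tower_horizontal _ _ _ _ (layer j 3)) => //.
    by apply: prod2_connected; [exact: real_connected|exact: itv_connected].
  by split; rewrite // yc_pt2 /= in_itv /= half_itv.
have stripes p : layer j 2 p ->
    connected_component (body j) (at_height p (mid R 2)) (base j).
  move=> p2; have [[k pk] _] := p2.
  pose p' := pt2 (xc p) (j%:R + 2^-1).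
  have p'2 : layer j 2 p' by split=> //; exists k; rewrite xc_pt2.
  have p'3 : layer j 3 p' by split; rewrite // yc_pt2 /= in_itv /= half_itv.
  apply: connected_component_trans (connected_component_trans
    (tower_climb (N := 4) _ p'2 p'3) (top _ p'3)) => //.
  apply: (@tower_horizontal _ _ _ _ (prod2
    `](k * n%:Z + j%:Z)%:~R, ((k * n%:Z + j%:Z)%:~R + 1)[%classic setT)) => //.
  - by apply: prod2_connected; [exact: itv_connected|exact: real_connected].
  - by move=> x [/= xk _]; split=> //; exists k; move: xk; rewrite in_itv.
  - by split => //; rewrite /= in_itv /= xc_pt2.
have bars p : layer j 1 p ->
    connected_component (body j) (at_height p (mid R 1)) (base j).
  move=> [i ij pi].
  have [x xj /andP[x1 x2]] := stripe_near (xc (q i)) (ltn_ord j).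
  pose p' := pt2 x (yc (q i)).
  have p'i : bar_of i p'.
    have := e_gt0 i; split; rewrite /= in_itv /= ?xc_pt2 ?yc_pt2;
      by apply/andP; split; lra.
  have p'1 : layer j 1 p' by exists i.
  have p'2 : layer j 2 p' by split=> //; rewrite xc_pt2.
  apply: connected_component_trans (connected_component_trans
    (tower_climb (N := 4) _ p'1 p'2) (stripes _ p'2)) => //.
  apply: (@tower_horizontal _ _ _ _ (bar_of i)) => //.
    by apply: prod2_connected; exact: itv_connected.
  by move=> z; exists i.
have ground p : layer j 0 p ->
    connected_component (body j) (at_height p (mid R 0)) (base j).
  move=> [i ij pi]; have q0 : layer j 0 (q i) by exists i.
  have q1 : layer j 1 (q i).
    exists i => //; have := e_gt0 i; have : 0 < (2 * n)%:R :> R.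
      by rewrite ltr0n muln_gt0 /=; exact: leq_ltn_trans (ltn_ord j).
    by split; rewrite /= in_itv /=; apply/andP; split; lra.
  apply: connected_component_trans (connected_component_trans
    (tower_climb (N := 4) _ q0 q1) (bars _ q1)) => //.
  apply: (@tower_horizontal _ _ _ _ (open_part (M i))) => //.
    exact: open_part_connected.
  by move=> z; exists i.
suff -> : body j = connected_component (body j) (base j).
  exact: component_connected.
apply/seteqP; split; last exact: connected_component_sub.
move=> p; rewrite -(at_heightK p) => /[dup] bp /tower_to_mid[k [k4 pk pmid]].
apply: connected_component_sym; apply: connected_component_trans pmid _.
by case: k k4 pk => [|[|[|[|//]]]] _; [exact: ground|exact: bars|
  exact: stripes|exact: top].
Qed.

Lemma body_open j : open (body j).
Proof. by apply: tower_open => k _; exact: layer_open. Qed.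

Lemma body_nonempty j : body j !=set0.
Proof.
exists (base j); apply: (@tower_floor _ _ _ _ _ 3) => //; last exact: mid_itv.
by split; rewrite // yc_pt2 /= in_itv /= half_itv.
Qed.

Definition solid j : region R 3 :=
  @Region R 3 (body j) (@body_nonempty j) (@body_open j) (@body_connected j).

Lemma solid_disjoint : disjoint_regions solid.
Proof.
move=> j j' _ _ [p pjj']; apply: contrapT => jj'.
suff : (body j `&` body j') p.
  by rewrite tower_disjoint // => k _; exact: layer_disjoint.
exact: pjj'.
Qed.

Lemma unit_square_region : exists S : region R 2,
  open_part S = prod2 `]0, 1[ `]0, 1[.
Proof.
pose Q : set 'rV[R]_2 := prod2 `]0, 1[ `]0, 1[.
have Q0 : Q !=set0.
  by exists (pt2 2^-1 2^-1); split; rewrite /= in_itv /= ?xc_pt2 ?yc_pt2;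
    apply/andP; split; lra.
have Qopen : open Q by apply: prod2_open; exact: interval_open.
have Qconnected : connected Q by apply: prod2_connected; exact: itv_connected.
by exists (Region Q0 Qopen Qconnected).
Qed.

(** The common surface is the unit square of height [3] over the place where
    the stripe of [j] crosses the strip of [j']: the first solid reaches it
    from below and the second from above. *)
Lemma solid_adjacent j j' : adjacent_regions (solid j) (solid j').
Proof.
have [S Sdef] := unit_square_region.
pose f (p : 'rV[R]_2) : 'rV[R]_(2 + 1) :=
  at_height (pt2 (j%:R + xc p) (j'%:R + yc p)) 3%:R.
pose g (p : 'rV[R]_(2 + 1)) : 'rV[R]_2 :=
  pt2 (- j%:R + xc (lsubmx p)) (- j'%:R + yc (lsubmx p)).
have cx : continuous (@xc R) by exact: coord_continuous.
have cy : continuous (@yc R) by exact: coord_continuous.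
have cf : continuous f.
  apply: continuous_at_height => [|x]; last exact: cst_continuous.
  by apply: continuous_pt2; exact: continuous_translate.
have cg : continuous g.
  have cl := @continuous_lsubmx R 1 2 1.
  by apply: continuous_pt2; apply: continuous_translate => p;
    apply: (continuous_comp (cl p)); [exact: cx|exact: cy].
exists S, f; split.
  split; first exact: continuous_subspaceT.
  exists g; split; last exact: continuous_subspaceT.
  by move=> p _; rewrite /g /f lsubmx_at xc_pt2 yc_pt2 !addKr pt2K.
have cv p : continuous (fun z : R => at_height p z : 'rV[R]_(2 + 1)).
  by apply: continuous_at_height => x; [exact: cst_continuous|exact: cvg_id].
have layer23 p : open_part S p ->
    layer j 2 (pt2 (j%:R + xc p) (j'%:R + yc p)) /\
    layer j' 3 (pt2 (j%:R + xc p) (j'%:R + yc p)).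
  rewrite Sdef => -[/= ]; rewrite !in_itv /= => /andP[x0 x1] /andP[y0 y1].
  split; split=> //.
    by exists 0; rewrite mul0r add0r -pmulrn xc_pt2; apply/andP; split; lra.
  by rewrite /= in_itv /= yc_pt2; apply/andP; split; lra.
move=> _ [p clp <-]; split;
  apply: (closure_continuous cf _ clp) => {clp}p /layer23[l2 l3].
  apply: (@closure_path_end _ _ _ (fun z => at_height _ z) 2%:R 3%:R) => //.
    by rewrite ltr_nat.
  by move=> t t23; apply: (@tower_floor _ _ _ _ _ 2).
apply: (@closure_path_start _ _ _ (fun z => at_height _ z) 3%:R 4%:R) => //.
  by rewrite ltr_nat.
by move=> t t34; apply: (@tower_floor _ _ _ _ _ 3).
Qed.

Lemma solid_base j : region_set (solid j) `&` @hyperplane R 2 =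
  @hyperplane_incl R 2 @` (\bigcup_(i in c @^-1` [set j]) region_set (M i)).
Proof.
have := @tower_base R 2 4 (layer j) isT.
by rewrite /= closure_bigcup_locally_finite.
Qed.

End construction.

Theorem theorem3p1 (R : realType) (n : nat) (I : Type) (M : I -> region R 2) :
  (0 < n)%N -> is_map M -> locally_finite M -> colorable n M ->
  exists Y : 'I_n -> region R 3, is_K Y /\ @cross_section R 2 I 'I_n M Y.
Proof.
move=> n0 [disjM _] lfM [c cM].
(* Every neighbourhood of a point contains points with the same abscissa and an
   ordinate in a prescribed dense set. *)
have [q qP] : {q : I -> 'rV[R]_2 & forall i,
    open_part (M i) (q i) /\ residue_fraction n (c i) (yc (q i))}.
  apply: (choice (P := fun i p =>
    open_part (M i) p /\ residue_fraction n (c i) (yc p))) => i.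
  have [p Up] := open_part_nonempty (M i).
  have : nbhs p (open_part (M i)).
    by apply: open_nbhs_nbhs; split=> //; exact: open_part_open.
  move=> /nbhs_ballP[e /= e0 eU].
  have [y yc_ /andP[y1 y2]] := @residue_fraction_dense R n (c i) (yc p) e n0 e0.
  exists (pt2 (xc p) y); rewrite yc_pt2; split=> //; apply: eU; split=> // k l.
  rewrite (ord1 k) mxE; case: eqP => [->|/ord2_max->]; first exact: ballxx.
  by rewrite -/(yc p) /ball /= ltr_norml; apply/andP; split; lra.
pose M' : {classic I} -> region R 2 := M.
have [e [e_gt0 bars_disjoint]] : exists e : {classic I} -> R,
    (forall i, 0 < e i) /\
    forall i j, c i <> c j ->
      bar (2 * n)%:R (q i) (e i) `&` bar (2 * n)%:R (q j) (e j) = set0.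
  apply: (@exists_disjoint_bars _ _ _ M') => //.
    by move=> i; apply: subset_closure; have [] := qP i.
  move=> i j ij yij; apply: ij; apply: val_inj; have [_ qi] := qP i.
  by have [_] := qP j; rewrite -yij; exact: residue_fraction_disjoint qi.
have Uq i : open_part (M i) (q i) by have [] := qP i.
exists (@solid R n {classic I} M' c q e Uq e_gt0); split.
  split; first exact: solid_disjoint.
  by move=> j j' _; exact: solid_adjacent.
exists c; split; first by move=> j; exact: solid_base.
by move=> i i' ii' cii' adj; exact: cM adj cii'.
Qed.
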